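(* Let $\mu,\nu$ be continuous Borel probability measures on $\mathbb{R}$, let $\rho=\frac12(\mu\times\delta_0+\delta_0\times\nu)$ be the additive measure on $\mathbb{R}^2$, and let $\Lambda\subset\mathbb{R}^2$ be a countable set. If $E(\Lambda)$ is a Riesz basis for $L^2(\rho)$, then at least one of the following holds: $E(\Lambda_x)$ is not a Riesz basis for $L^2(\mu)$, or $E(\Lambda_y)$ is not a Riesz basis for $L^2(\nu)$.
   Context: A Borel measure $\mu$ on $\mathbb{R}$ is continuous if $\mu(\{x\})=0$ for all $x\in\mathbb{R}$. $\delta_0$ is the Dirac measure at $0$. Thus $\int F\,d\rho=\frac12\int F(x,0)\,d\mu(x)+\frac12\int F(0,y)\,d\nu(y)$. For $\Lambda\subset\mathbb{R}^2$, $\Lambda_x=\{a\in\mathbb{R}:(a,b)\in\Lambda\text{ for some }b\in\mathbb{R}\}$ and $\Lambda_y=\{b\in\mathbb{R}:(a,b)\in\Lambda\text{ for some }a\in\mathbb{R}\}$ (as sets, without multiplicity). For a point $\lambda\in\mathbb{R}^d$ ($d=1,2$), $e_\lambda(x)=e^{2\pi i\lambda\cdot x}$, and for a countable set $\Lambda\subset\mathbb{R}^d$, $E(\Lambda)=\{e_\lambda:\lambda\in\Lambda\}$. For a Borel probability measure $\sigma$ on $\mathbb{R}^d$, $E(\Lambda)$ is a frame for $L^2(\sigma)$ if there are constants $A,B>0$ with $A\|f\|^2\le\sum_{\lambda\in\Lambda}|\langle f,e_\lambda\rangle|^2\le B\|f\|^2$ for all $f\in L^2(\sigma)$. $E(\Lambda)$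 is a Riesz basis for $L^2(\sigma)$ if it is a frame and there are constants $A,B>0$ such that $A\sum|c_\lambda|^2\le\|\sum c_\lambda e_\lambda\|^2\le B\sum|c_\lambda|^2$ for every family $(c_\lambda)_{\lambda\in\Lambda}$ of complex numbers with only finitely many nonzero terms. *)

(* Defs.v *)
From HB Require Import structures.
From mathcomp Require Import all_boot all_order all_algebra.
From mathcomp Require Import complex.
From mathcomp Require Import all_classical all_reals all_analysis.

Set Implicit Arguments.
Unset Strict Implicit.
Unset Printing Implicit Defensive.
Import Order.TTheory GRing.Theory Num.Theory.
Import numFieldNormedType.Exports.
Local Open Scope classical_set_scope.
Local Open Scope ring_scope.

Section complex_L2.
Context d (T : measurableType d) (R : realType).
Variable sigma : {measure set T -> \bar R}.
Implicit Types f g : T -> R[i].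

(* Elements of L^2(sigma) are handled through representatives; none of the
   quantities below depends on the choice of the representative. *)
Definition sqnorm2 f : \bar R :=
  (\int[sigma]_x (ComplexField.Normc.normc (f x) ^+ 2)%:E)%E.

Definition inL2 f : Prop :=
  [/\ measurable_fun setT (fun x => complex.Re (f x)),
      measurable_fun setT (fun x => complex.Im (f x))
    & (sqnorm2 f < +oo)%E].

Definition inner2 f g : R[i] :=
  Complex (\int[sigma]_x complex.Re (f x * conjc (g x)))
          (\int[sigma]_x complex.Im (f x * conjc (g x))).

(* A countable system of functions is given by a family [e] together with the
   set [Lambda] of the indices that are used. *)
Context (I : choiceType) (e : I -> T -> R[i]) (Lambda : set I).

Definition is_frame : Prop :=
  exists A B : R, [/\ 0 < A, 0 < B & forall f, inL2 f ->
    (A%:E * sqnorm2 f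
      <= \esum_(l in Lambda) (ComplexField.Normc.normc (inner2 f (e l)) ^+ 2)%:E
      <= B%:E * sqnorm2 f)%E].

Definition is_riesz_sequence : Prop :=
  exists A B : R, [/\ 0 < A, 0 < B & forall c : I -> R[i],
    finite_set (Lambda `&` [set l | c l != 0]) ->
    ((A * \sum_(l \in Lambda) ComplexField.Normc.normc (c l) ^+ 2)%R%:E
      <= sqnorm2 (fun x => (\sum_(l \in Lambda) c l * e l x)%R)
      <= (B * \sum_(l \in Lambda) ComplexField.Normc.normc (c l) ^+ 2)%R%:E)%E].

Definition is_riesz_basis : Prop := is_frame /\ is_riesz_sequence.

End complex_L2.

Section exponentials.
Variable R : realType.

Definition expi (t : R) : R[i] := Complex (cos t) (sin t).

Definition e_line (l : R) (x : measurableTypeR R) : R[i] :=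
  expi (2 * pi * (l * x)).

Definition e_plane (l : R * R) (x : measurableTypeR R * measurableTypeR R)
    : R[i] :=
  expi (2 * pi * (l.1 * x.1 + l.2 * x.2)).

Definition continuous_measure (mu : {measure set (measurableTypeR R) -> \bar R})
    : Prop :=
  forall x : R, mu [set x] = 0%E.

Definition proj_x (Lambda : set (R * R)) : set R :=
  [set a | exists b, Lambda (a, b)].

Definition proj_y (Lambda : set (R * R)) : set R :=
  [set b | exists a, Lambda (a, b)].

Definition additive_measure (mu nu : probability (measurableTypeR R) R) :=
  mscale (2^-1)%:nng
    (measure_add (mu \x (\d_ (0%R : measurableTypeR R)))%E
                 ((\d_ (0%R : measurableTypeR R)) \x nu)%E).

End exponentials.

(* Main.v *)
Require Import Defs.
From mathcomp Require Import all_boot all_order all_algebra.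
From mathcomp Require Import complex.
From mathcomp Require Import all_classical all_reals all_analysis.
From mathcomp Require Import measurable_realfun.
From mathcomp Require Import ring lra.

(** Read [Lambda] as the edge set of a bipartite graph: the vertices are the
    points of its two projections, and [(a, b)] joins [a] to [b].  On the two
    axes, which carry the additive measure, the exponential of [(a, b)] restricts
    to the exponentials of [a] and of [b].  So if all three systems were Riesz
    bases, L2 norms could be replaced by l2 norms of coefficients, and the
    (signed) incidence operator [boundary], which sends an edge to the difference
    of its ends, would be an isomorphism from l2 of the edges onto l2 of the
    vertices.  No nonempty graph allows that ([incidence_not_invertible]).

    The reason is that the inverse would have integer entries.  Fix an edge [lam].
    The [lam]-coordinate [edge_coord lam v] of the preimage of the unit mass at
    [v] is a square-summable function of [v]; across an edge [mu] it jumps by 1 if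
    [mu = lam] and by 0 otherwise ([edge_coord_jump]).  A nonzero level set of such
    a function is finite ([edge_coord_decay]).  A finite nonempty set of vertices
    that no edge leaves cannot exist, because its indicator would be orthogonal to
    the dense range of [boundary] ([saturated_nil]).  Hence every level set of a
    nonzero value has to meet an end of [lam], which leaves only the values 0, 1
    and -1 ([edge_coord_integral]).  Now fix [v] instead and let [lam] vary: these
    coordinates are approximated uniformly in [lam] by those of a finitely
    supported function, and being integers they vanish outside a finite set of
    edges.  The preimage of the unit mass at [v] is thus finitely supported; but
    the total mass of the boundary of a finitely supported function is 0, not 1.

    Everything is done with finite formal combinations and approximations, so that
    neither l2 spaces nor the completeness of L2 occur.  In particular the density
    of the exponential polynomials follows from the frame inequality applied to
    the error of a nearly optimal approximation ([frame_dense]). *)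

Set Implicit Arguments.
Unset Strict Implicit.
Unset Printing Implicit Defensive.
Import Order.TTheory GRing.Theory Num.Theory.
Import numFieldNormedType.Exports.
Local Open Scope classical_set_scope.
Local Open Scope ring_scope.

Local Notation normc := ComplexField.Normc.normc.
Local Notation Re := complex.Re.
Local Notation Im := complex.Im.

(** * Formal linear combinations *)

Section Combinations.
Context (S : comPzRingType) (I : choiceType).
Implicit Types (l : seq (S * I)) (i : I) (f : I -> S).

(** A finitely supported function [I -> S] is encoded as a list of terms in which
    an index may be repeated: sums are then concatenations, and every linear
    expression in the coefficients is a sum over the list. *)
Definition lincomb l f : S := \sum_(p <- l) p.1 * f p.2.

Definition coef l i : S := lincomb l (fun j => (j == i)%:R).

Definition scalel (a : S) l := [seq (a * p.1, p.2) | p <- l].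

Definition indices l : seq I := undup [seq p.2 | p <- l].

Lemma lincomb_cons p l f : lincomb (p :: l) f = p.1 * f p.2 + lincomb l f.
Proof. exact: big_cons. Qed.

Lemma lincomb_cat l1 l2 f : lincomb (l1 ++ l2) f = lincomb l1 f + lincomb l2 f.
Proof. by rewrite /lincomb big_cat. Qed.

Lemma lincomb_scale a l f : lincomb (scalel a l) f = a * lincomb l f.
Proof. by rewrite /lincomb big_map mulr_sumr; apply: eq_bigr => p _; rewrite mulrA. Qed.

Lemma lincomb_fun (r : seq I) (c f : I -> S) :
  lincomb [seq (c i, i) | i <- r] f = \sum_(i <- r) c i * f i.
Proof. by rewrite /lincomb big_map. Qed.

Lemma sum_delta (r : seq I) j f : uniq r ->
  \sum_(i <- r) (j == i)%:R * f i = if j \in r then f j else 0.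
Proof.
move=> ur; case: ifPn => jr.
  rewrite (bigD1_seq j) //= eqxx mul1r big1 ?addr0 // => i ij.
  by rewrite eq_sym (negbTE ij) mul0r.
rewrite big_seq big1 // => i ir; case: eqP => [ji|]; last by rewrite mul0r.
by rewrite ji ir in jr.
Qed.

Lemma sum_indicator (r : seq I) j : uniq r ->
  \sum_(i <- r) (j == i)%:R = (j \in r)%:R :> S.
Proof.
move=> ur; have := sum_delta j (fun=> 1) ur.
by under eq_bigr do rewrite mulr1; move=> ->; case: ifP.
Qed.

Lemma lincomb_coef l f (r : seq I) : uniq r -> {subset indices l <= r} ->
  lincomb l f = \sum_(i <- r) coef l i * f i.
Proof.
move=> ur lr; rewrite /coef /lincomb.
under [RHS]eq_bigr do rewrite mulr_suml.
rewrite exchange_big /= big_seq [RHS]big_seq; apply: eq_bigr => p pl.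
under eq_bigr do rewrite -mulrA.
rewrite -mulr_sumr sum_delta // lr // mem_undup.
by apply/mapP; exists p.
Qed.

Lemma coef_out l i : i \notin indices l -> coef l i = 0.
Proof.
rewrite mem_undup => il; rewrite /coef /lincomb big_seq big1 // => p pl.
case: eqP => [pi|]; last by rewrite mulr0.
by case/negP: il; rewrite -pi; apply: map_f.
Qed.

Lemma coef_fun (r : seq I) (c : I -> S) i : uniq r ->
  coef [seq (c i, i) | i <- r] i = if i \in r then c i else 0.
Proof.
move=> ur; rewrite /coef lincomb_fun -(sum_delta i c ur).
by apply: eq_bigr => j _; rewrite mulrC eq_sym.
Qed.

Definition supported (A : set I) l : Prop := forall i, i \in indices l -> A i.

Lemma supported_cat A l1 l2 : supported A l1 -> supported A l2 -> supported A (l1 ++ l2).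
Proof.
move=> o1 o2 lam; rewrite mem_undup map_cat mem_cat.
by case/orP => [h|h]; [apply: o1|apply: o2]; rewrite mem_undup.
Qed.

Lemma indices_scale (a : S) l : indices (scalel a l) = indices l.
Proof. by rewrite /indices -map_comp. Qed.

Lemma supported_scale A a l : supported A l -> supported A (scalel a l).
Proof. by move=> o i; rewrite indices_scale; apply: o. Qed.

Lemma indices_fun (r : seq I) (c : I -> S) : uniq r -> indices [seq (c i, i) | i <- r] = r.
Proof. by move=> ur; rewrite /indices -map_comp map_id undup_id. Qed.

End Combinations.

Section MoreCombinations.
Context (I J : choiceType).

Definition relabel (S : comPzRingType) (h : I -> J) (l : seq (S * I)) : seq (S * J) :=
  [seq (p.1, h p.2) | p <- l].

Lemma lincomb_relabel (S : comPzRingType) h (l : seq (S * I)) f :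
  lincomb (relabel h l) f = lincomb l (f \o h).
Proof. by rewrite /lincomb big_map. Qed.

Lemma sum_le_on (R : realDomainType) (F : I -> R) (r s : seq I) : uniq r -> uniq s ->
  (forall i, 0 <= F i) -> (forall i, i \notin r -> F i = 0) ->
  \sum_(i <- s) F i <= \sum_(i <- r) F i.
Proof.
move=> ur us F0 Fr.
have -> : \sum_(i <- s) F i = \sum_(i <- [seq i <- r | i \in s]) F i.
  rewrite (bigID (mem r)) /= [X in _ + X]big1 ?addr0 => [|i /Fr//].
  rewrite -big_filter; apply: perm_big; apply: uniq_perm; rewrite ?filter_uniq// => i.
  by rewrite !mem_filter andbC.
by rewrite big_filter [leRHS](bigID (mem s)) /= lerDl sumr_ge0.
Qed.

End MoreCombinations.

(** Enumerates a predicate from a bound on its finite subsets, removing one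
    element at a time. *)
Lemma finite_pred_seq (T : choiceType) (P : T -> Prop) n :
  (forall s : seq T, uniq s -> (forall x, x \in s -> P x) -> (size s <= n)%N) ->
  exists2 s : seq T, uniq s & forall x, x \in s <-> P x.
Proof.
elim: n P => [|n IH] P h.
  exists [::] => // x; split=> // Px.
  by have := h [:: x] isT; apply => y; rewrite inE => /eqP->.
have [[x Px]|nP] := pselect (exists x, P x); last first.
  by exists [::] => // x; split=> // Px; case: nP; exists x.
have [s us sP] : exists2 s : seq T, uniq s & forall y, y \in s <-> (P y /\ y <> x).
  apply: IH => s us sP.
  have := h (x :: s); rewrite /= ltnS; apply.
    by rewrite us andbT; apply/negP => /sP [].
  by move=> y; rewrite inE => /orP[/eqP->//|/sP[]].
exists (x :: s) => [|y] /=; first by rewrite us andbT; apply/negP => /sP [].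
rewrite inE; split=> [/orP[/eqP->//|/sP[]//]|Py].
by case: eqVneq => //= yx; apply/sP; split => //; apply/eqP.
Qed.

(** * Incidence operators of graphs on square-summable functions *)

Section Graph.
Context (R : realType) (V E : choiceType) (src tgt : E -> V) (Lambda : set E).
Implicit Types (l : seq (R * E)) (u : V -> R) (v w : V) (lam : E).

Definition incidence lam w : R := (src lam == w)%:R - (tgt lam == w)%:R.

Definition boundary l w : R := lincomb l (incidence^~ w).

(** The bound [r] on the l2 norm of [u], tested on finite sets, so that it makes
    sense for arbitrary functions. *)
Definition l2_le u (r : R) : Prop :=
  0 <= r /\ forall s : seq V, uniq s -> \sum_(w <- s) u w ^+ 2 <= r ^+ 2.

Definition vdelta v w : R := (v == w)%:R.

Definition vertex v : Prop := exists2 lam, Lambda lam & src lam = v \/ tgt lam = v.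

Lemma l2_le0 : l2_le (fun=> 0) 0.
Proof. by split=> // s _; rewrite expr0n big1 // => w _; rewrite expr0n. Qed.

(** The factor 2 replaces the triangle inequality by the convexity of the square;
    only the existence of constants matters in what follows. *)
Lemma l2_leD u u' r r' : l2_le u r -> l2_le u' r' ->
  l2_le (fun w => u w + u' w) (2 * (r + r')).
Proof.
move=> [r0 ur] [r0' ur']; split=> [|s us]; first by rewrite mulr_ge0 ?addr_ge0.
have : \sum_(w <- s) (u w + u' w) ^+ 2 <=
  2 * \sum_(w <- s) u w ^+ 2 + 2 * \sum_(w <- s) u' w ^+ 2.
  rewrite !mulr_sumr -big_split /=; apply: ler_sum => w _.
  by have := sqr_ge0 (u w - u' w); nra.
by have := ur _ us; have := ur' _ us; nra.
Qed.

Lemma l2_leZ a u r : l2_le u r -> l2_le (fun w => a * u w) (`|a| * r).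
Proof.
move=> [r0 ur]; split=> [|s us]; first by rewrite mulr_ge0.
under eq_bigr do rewrite exprMn.
by rewrite -mulr_sumr exprMn real_normK ?num_real// ler_wpM2l ?sqr_ge0 ?ur.
Qed.

Lemma l2_le_ext u u' r : u =1 u' -> l2_le u r -> l2_le u' r.
Proof. by move=> /funext ->. Qed.

Lemma l2_leW u r r' : l2_le u r -> r <= r' -> l2_le u r'.
Proof.
move=> [r0 ur] rr'; split=> [|s us]; first exact: le_trans rr'.
by apply: (le_trans (ur s us)); rewrite lerXn2r ?nnegrE// (le_trans r0).
Qed.

Lemma l2_le_pt u r w : l2_le u r -> `|u w| <= r.
Proof.
move=> [r0 /(_ [:: w] isT)]; rewrite big_seq1 => h.
by rewrite -(@ler_pXn2r _ 2) ?nnegrE// real_normK ?num_real.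
Qed.

Lemma l2_le_sum u r (s : seq V) : l2_le u r ->
  `|\sum_(w <- s) u w| <= (size s)%:R * r.
Proof.
move=> ur; apply: (le_trans (ler_norm_sum _ _ _)).
rewrite -(count_predT s) mulr_natl -iter_addr_0 -big_const_seq.
by apply: ler_sum => w _; apply: l2_le_pt.
Qed.

Lemma l2_le_indicator (s : seq V) (a : V -> R) : uniq s ->
  (forall v, `|a v| <= 1) ->
  l2_le (fun w => \sum_(v <- s) a v * vdelta v w) (Num.sqrt (size s)%:R).
Proof.
move=> us a1; split=> [|t ut]; first exact: sqrtr_ge0.
rewrite sqr_sqrtr ?ler0n//.
have -> : \sum_(w <- t) (\sum_(v <- s) a v * vdelta v w) ^+ 2 =
    \sum_(w <- t) (if w \in s then a w else 0) ^+ 2.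
  apply: eq_bigr => w _; rewrite -(sum_delta w a us); congr (_ ^+ 2).
  by apply: eq_bigr => v _; rewrite mulrC /vdelta eq_sym.
apply: (@le_trans _ _ (size [seq w <- t | w \in s])%:R).
  rewrite size_filter -sum1_count natr_sum [leRHS]big_mkcond /=.
  apply: ler_sum => w _; case: ifP => _; last by rewrite expr0n.
  by rewrite -real_normK ?num_real// expr_le1.
rewrite ler_nat uniq_leq_size ?filter_uniq// => w.
by rewrite mem_filter => /andP[].
Qed.

Lemma boundary_cat l1 l2 w : boundary (l1 ++ l2) w = boundary l1 w + boundary l2 w.
Proof. exact: lincomb_cat. Qed.

Lemma coef_cat l1 l2 lam : coef (l1 ++ l2) lam = coef l1 lam + coef l2 lam.
Proof. exact: lincomb_cat. Qed.

(** The graph of the [lam]-coordinate of the inverse of the closure of [boundary]: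
    [u] is an l2 limit of boundaries of combinations whose [lam]-coefficients
    tend to [x]. *)
Definition limit_coef lam u x : Prop := forall eps, 0 < eps -> exists l,
  [/\ supported Lambda l, l2_le (fun w => u w - boundary l w) eps & `|x - coef l lam| <= eps].

Lemma limit_coef_ext lam u u' x : u =1 u' -> limit_coef lam u x -> limit_coef lam u' x.
Proof. by move=> /funext ->. Qed.

Lemma limit_coef_boundary lam l : supported Lambda l -> limit_coef lam (boundary l) (coef l lam).
Proof.
move=> ol eps e0; exists l; rewrite subrr normr0; split=> //; last exact: ltW.
apply: l2_leW (ltW e0); apply: l2_le_ext l2_le0 => w.
by rewrite subrr.
Qed.

Lemma limit_coefD lam u u' x x' : limit_coef lam u x -> limit_coef lam u' x' ->
  limit_coef lam (fun w => u w + u' w) (x + x').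
Proof.
move=> ux ux' eps e0; have e4 : 0 < eps / 4 by rewrite divr_gt0.
have [l [ol ul xl]] := ux _ e4; have [l' [ol' ul' xl']] := ux' _ e4.
exists (l ++ l'); split; first exact: supported_cat.
  apply: (@l2_le_ext (fun w => (u w - boundary l w) + (u' w - boundary l' w))).
    by move=> w; rewrite boundary_cat; ring.
  by apply: l2_leW (l2_leD ul ul') _; lra.
rewrite coef_cat; move: xl xl'; rewrite !ler_norml.
by move=> /andP[? ?] /andP[? ?]; apply/andP; split; lra.
Qed.

Lemma limit_coefZ a lam u x : limit_coef lam u x -> limit_coef lam (fun w => a * u w) (a * x).
Proof.
move=> ux eps e0; have a1 : 0 < `|a| + 1 by rewrite ltr_pwDr.
have [l [ol ul xl]] := ux _ (divr_gt0 e0 a1).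
have ae : `|a| * (eps / (`|a| + 1)) <= eps.
  by rewrite mulrCA ger_pMr// ler_pdivrMr// mul1r lerDl.
exists (scalel a l); split.
- exact: supported_scale.
- apply: (@l2_le_ext (fun w => a * (u w - boundary l w))).
    by move=> w; rewrite /boundary lincomb_scale; ring.
  exact: l2_leW (l2_leZ _ ul) _.
- rewrite /coef lincomb_scale -mulrBr normrM.
  by apply: le_trans ae; rewrite ler_wpM2l.
Qed.

Lemma limit_coef_sum lam (s : seq V) (a g : V -> R) :
  (forall v, v \in s -> limit_coef lam (vdelta v) (g v)) ->
  limit_coef lam (fun w => \sum_(v <- s) a v * vdelta v w) (\sum_(v <- s) a v * g v).
Proof.
elim: s => [|v s IH] h.
  rewrite big_nil; apply: (@limit_coef_ext _ (boundary [::])).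
    by move=> w; rewrite big_nil /boundary /lincomb big_nil.
  have -> : 0 = coef [::] lam :> R by rewrite /coef /lincomb big_nil.
  exact: limit_coef_boundary.
rewrite big_cons.
apply: (@limit_coef_ext _ (fun w => a v * vdelta v w + \sum_(v <- s) a v * vdelta v w)).
  by move=> w; rewrite big_cons.
apply: limit_coefD; first by apply/limit_coefZ/h; rewrite mem_head.
by apply: IH => w ws; apply: h; rewrite in_cons ws orbT.
Qed.

Context (K C : R).
Hypothesis (K_gt0 : 0 < K).
(** [lower] and [upper] are pointwise forms of the two Riesz inequalities for the
    columns of the incidence operator; [dense] says that its range is dense. *)
Hypothesis lower : forall l lam r, supported Lambda l -> l2_le (boundary l) r ->
  `|coef l lam| <= K * r.
Hypothesis upper : forall (F : seq E) (c : E -> R) w, uniq F ->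
  (forall lam, lam \in F -> Lambda lam) ->
  (\sum_(lam <- F) c lam * incidence lam w) ^+ 2 <= C * \sum_(lam <- F) c lam ^+ 2.
Hypothesis dense : forall v eps, vertex v -> 0 < eps -> exists l,
  supported Lambda l /\ l2_le (fun w => vdelta v w - boundary l w) eps.

(** The lower bound [lower] passes to limits, which makes [limit_coef lam] the
    graph of a bounded linear functional. *)
Lemma limit_coef_bound lam u x r : limit_coef lam u x -> l2_le u r -> `|x| <= 2 * K * r.
Proof.
move=> ux ur; apply/ler_addgt0Pr => e e0.
have K1 : 0 < 1 + 2 * K by rewrite ltr_pwDl// mulr_ge0// ltW.
have [l [ol ul xl]] := ux _ (divr_gt0 e0 K1).
set d := e / _ in ul xl; have de : d * (1 + 2 * K) = e by rewrite divfK// gt_eqF.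
have lr : l2_le (boundary l) (2 * (r + d)).
  apply: (@l2_le_ext (fun w => u w + (-1) * (u w - boundary l w))).
    by move=> w; ring.
  apply: l2_leD => //; have := l2_leZ (-1) ul.
  by rewrite normrN1 mul1r.
have := lower lam ol lr; move: xl; rewrite !ler_norml.
by move=> /andP[? ?] /andP[? ?]; apply/andP; split; lra.
Qed.

Lemma limit_coef_uniq lam u x x' : limit_coef lam u x -> limit_coef lam u x' -> x = x'.
Proof.
move=> ux ux'; apply/eqP; rewrite -subr_eq0 -normr_le0.
rewrite -(mulr0 (2 * K)); apply: (limit_coef_bound (lam := lam)) l2_le0.
have := limit_coefD ux (limit_coefZ (-1) ux'); rewrite mulN1r.
by apply: limit_coef_ext => w; rewrite mulN1r subrr.
Qed.

(** Each combination [l] at distance [r] from the target confines the sought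
    coordinate to the interval of radius [2 * K * r] around [coef l lam].  By
    [lower] any two of these intervals meet, so the supremum of their left ends
    lies in all of them. *)
Lemma limit_coef_ex lam v : vertex v -> exists x, limit_coef lam (vdelta v) x.
Proof.
move=> vv.
(* Left ends of the confining intervals. *)
pose Z := [set z | exists l r, [/\ supported Lambda l, l2_le (fun w => vdelta v w - boundary l w) r
   & z = coef l lam - 2 * K * r]].
have Zub l r : supported Lambda l -> l2_le (fun w => vdelta v w - boundary l w) r ->
    ubound Z (coef l lam + 2 * K * r).
  move=> ol lr _ [l' [r' [ol' lr' ->]]].
  have o' : supported Lambda (l' ++ scalel (-1) l).
    by apply: supported_cat => //; apply: supported_scale.
  have b' : l2_le (boundary (l' ++ scalel (-1) l)) (2 * (r + r')).
    have := l2_leD lr (l2_leZ (-1) lr'); rewrite normrN1 mul1r.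
    by apply: l2_le_ext => w; rewrite boundary_cat /boundary lincomb_scale; ring.
  have := lower lam o' b'; rewrite coef_cat /coef lincomb_scale ler_norml.
  by move=> /andP[? ?]; lra.
have supx l r : supported Lambda l -> l2_le (fun w => vdelta v w - boundary l w) r ->
    `|sup Z - coef l lam| <= 2 * K * r.
  move=> ol lr; rewrite ler_norml; apply/andP; split.
    rewrite lerBrDl; apply: ub_le_sup; first by exists (coef l lam + 2 * K * r); apply: Zub.
    by exists l, r.
  rewrite lerBlDl; apply: ge_sup; last exact: Zub.
  by exists (coef l lam - 2 * K * r), l, r.
exists (sup Z) => eps e0.
have d0 : 0 < Num.min eps (eps / (2 * K)) by rewrite lt_min e0 divr_gt0// mulr_gt0.
have [l [ol lr]] := dense vv d0; exists l; split=> //.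
  by apply: l2_leW lr _; rewrite ge_min lexx.
apply: le_trans (supx _ _ ol lr) _.
by rewrite mulrC -ler_pdivlMr ?mulr_gt0// ge_min lexx orbT.
Qed.

Definition edge_coord lam v : R := xget 0 [set x | limit_coef lam (vdelta v) x].

Lemma edge_coordP lam v : vertex v -> limit_coef lam (vdelta v) (edge_coord lam v).
Proof. by move=> /(limit_coef_ex lam) [x ax]; rewrite /edge_coord; case: xgetP => // /(_ x). Qed.

(** The boundary of the single edge [mu] is the difference of the unit masses at
    its ends, and its [lam]-coefficient is known; uniqueness compares the two. *)
Lemma edge_coord_jump lam mu : Lambda mu ->
  edge_coord lam (src mu) - edge_coord lam (tgt mu) = (mu == lam)%:R.
Proof.
move=> Lmu.
have vs : vertex (src mu) by exists mu => //; left.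
have vt : vertex (tgt mu) by exists mu => //; right.
have -> : (mu == lam)%:R = coef [:: (1 : R, mu)] lam.
  by rewrite /coef /lincomb big_seq1 /= mul1r.
have ol : supported Lambda [:: (1 : R, mu)] by move=> i; rewrite /indices /= inE => /eqP ->.
apply: (@limit_coef_uniq lam (boundary [:: (1, mu)])); last exact: limit_coef_boundary.
have := limit_coefD (edge_coordP lam vs) (limit_coefZ (-1) (edge_coordP lam vt)).
rewrite mulN1r; apply: limit_coef_ext => w.
by rewrite /boundary /lincomb big_seq1 /= /incidence /vdelta; ring.
Qed.

(** The functional [limit_coef lam] is bounded by a multiple of the l2 norm.  On the
    sum of signed unit masses over [n] vertices where [edge_coord lam] is at least
    [m] in modulus, it is at least [m * n], while the norm is the square root of
    [n]; this bounds [n]. *)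
Lemma edge_coord_decay lam m : 0 < m ->
  exists2 s : seq V, uniq s & forall v, v \in s <-> vertex v /\ m <= `|edge_coord lam v|.
Proof.
move=> m0; pose B := (2 * K / m) ^+ 2.
apply: (@finite_pred_seq _ _ (Num.truncn B)) => s us sP.
have a1 v : `|Num.sg (edge_coord lam v)| <= 1 by rewrite normr_sg lern1 leq_b1.
have := limit_coef_bound (limit_coef_sum (fun v => Num.sg (edge_coord lam v))
  (fun v vs => edge_coordP lam (sP v vs).1)) (l2_le_indicator us a1).
set S := \sum_(_ <- _) _; move=> Sle.
have mS : m * (size s)%:R <= S.
  rewrite mulrC mulr_natl -(count_predT s) -iter_addr_0 -big_const_seq.
  rewrite /S big_seq [leRHS]big_seq; apply: ler_sum => v vs.
  by rewrite -normrEsg; case: (sP v vs).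
have {Sle} : m * (size s)%:R <= 2 * K * Num.sqrt (size s)%:R.
  by apply: le_trans Sle; apply: le_trans mS _; exact: ler_norm.
have sz : (size s)%:R = Num.sqrt (size s)%:R ^+ 2 :> R by rewrite sqr_sqrtr.
move=> le1; rewrite -ltnS -(ltr_nat R).
apply: le_lt_trans (truncnS_gt _); rewrite /B sz.
apply: lerXn2r; rewrite ?nnegrE ?sqrtr_ge0 ?divr_ge0 ?mulr_ge0 ?(ltW m0) ?(ltW K_gt0)//.
rewrite ler_pdivlMr//; have [->|n0] := eqVneq (Num.sqrt (size s)%:R : R) 0.
  by rewrite mul0r mulr_ge0 ?ltW.
have sp : 0 < Num.sqrt (size s)%:R :> R by rewrite lt_def n0 sqrtr_ge0.
by rewrite -(ler_pM2r sp) -mulrA mulrCA -expr2 -sz.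
Qed.

(** Summation over [s] kills every boundary, because each edge has both or none of
    its ends in [s], but it gives 1 on the unit mass at a vertex of [s].  It is
    continuous on a finite set, so density leaves only the empty set. *)
Lemma saturated_nil (s : seq V) : uniq s ->
  (forall v, v \in s -> vertex v) ->
  (forall lam, Lambda lam -> (src lam \in s) = (tgt lam \in s)) -> s = [::].
Proof.
move=> us vs inv; case sE: s => [//|v s']; exfalso.
have v_s : v \in s by rewrite sE mem_head.
have n0 : 0 < (size s)%:R :> R by rewrite sE ltr0n.
have e0 : 0 < ((size s)%:R * 2)^-1 :> R by rewrite invr_gt0 mulr_gt0.
have [l [ol lr]] := dense (vs v v_s) e0.
have := l2_le_sum s lr; rewrite sumrB.
have -> : \sum_(w <- s) vdelta v w = 1 by rewrite sum_indicator// v_s.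
have -> : \sum_(w <- s) boundary l w = 0.
  rewrite /boundary /lincomb exchange_big /= big_seq big1 // => p pl.
  rewrite -mulr_sumr /incidence sumrB.
  rewrite !sum_indicator// inv ?subrr ?mulr0//; apply: ol.
  by rewrite mem_undup map_f.
rewrite subr0 normr1 invfM mulrA divff ?gt_eqF// mul1r; lra.
Qed.

(** The set where [edge_coord lam] takes the values [b] or [c] is finite.  Edges
    other than [lam] do not leave it since they do not change the value, and
    the hypothesis says the same of [lam]. *)
Lemma edge_coord_levels lam b c : Lambda lam -> b != 0 -> c != 0 ->
  (edge_coord lam (src lam) \in [:: b; c]) = (edge_coord lam (tgt lam) \in [:: b; c]) ->
  forall v, vertex v -> edge_coord lam v \notin [:: b; c].
Proof.
move=> Ll b0 c0 inv v vv; apply/negP => vbc.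
have m0 : 0 < Num.min `|b| `|c| by rewrite lt_min !normr_gt0 b0.
have [s us sP] := edge_coord_decay lam m0.
have mbc w : edge_coord lam w \in [:: b; c] -> Num.min `|b| `|c| <= `|edge_coord lam w|.
  by rewrite !inE => /orP[]/eqP->; rewrite ge_min lexx ?orbT.
pose s' := [seq w <- s | edge_coord lam w \in [:: b; c]].
have s'P w : vertex w -> (w \in s') = (edge_coord lam w \in [:: b; c]).
  move=> vw; rewrite mem_filter; case vbcE: (_ \in [:: b; c]) => //=.
  by apply/sP; split=> //; apply: mbc.
have : s' = [::].
  apply: saturated_nil.
  - by rewrite filter_uniq.
  - by move=> w; rewrite mem_filter => /andP[_ /sP[]].
  - move=> mu Lmu.
    have vs : vertex (src mu) by exists mu => //; left.
    have vt : vertex (tgt mu) by exists mu => //; right.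
    rewrite !s'P//; have [->//|ml] := eqVneq mu lam.
    have := edge_coord_jump lam Lmu; rewrite (negbTE ml) => /eqP.
    by rewrite subr_eq0 => /eqP ->.
by move=> s0; have := s'P _ vv; rewrite s0 vbc.
Qed.

(** The values at the two ends of [lam] are [x] and [x - 1].  If both were nonzero,
    the levels [x] and [x - 1] together would contradict [edge_coord_levels]; so
    one of them is 0 and the other is 1 or -1.  A nonzero level different from
    both misses the ends of [lam], and is ruled out in the same way. *)
Lemma edge_coord_integral lam v : Lambda lam -> vertex v ->
  edge_coord lam v = 0 \/ `|edge_coord lam v| = 1.
Proof.
move=> Ll vv.
have vs : vertex (src lam) by exists lam => //; left.
have := edge_coord_jump lam Ll; rewrite eqxx mulr1n => /eqP; rewrite subr_eq => /eqP st.
have [t0|t0] := eqVneq (edge_coord lam (tgt lam)) 0; last first.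
  have [s0|s0] := eqVneq (edge_coord lam (src lam)) 0; last first.
    have := edge_coord_levels Ll s0 t0 _ vs; rewrite !inE !eqxx orbT /=.
    by move=> /(_ erefl).
  have t1 : edge_coord lam (tgt lam) = -1 by lra.
  have [v0|v0] := eqVneq (edge_coord lam v) 0; [by left|right].
  have [->|v1] := eqVneq (edge_coord lam v) (- 1); first by rewrite normrN1.
  have := edge_coord_levels Ll v0 v0 _ vv; rewrite !inE !eqxx /= !orbb.
  rewrite s0 t1 [0 == _]eq_sym (negbTE v0) [-1 == _]eq_sym (negbTE v1).
  by move=> /(_ erefl).
have s1 : edge_coord lam (src lam) = 1 by lra.
have [v0|v0] := eqVneq (edge_coord lam v) 0; [by left|right].
have [->|v1] := eqVneq (edge_coord lam v) 1; first by rewrite normr1.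
have := edge_coord_levels Ll v0 v0 _ vv; rewrite !inE !eqxx /= !orbb.
rewrite s1 t0 [0 == _]eq_sym (negbTE v0) [1 == _]eq_sym (negbTE v1).
by move=> /(_ erefl).
Qed.

Hypothesis C_ge0 : 0 <= C.

(** Testing [upper] with the entries of row [w] of the incidence matrix as
    coefficients gives [x ^+ 2 <= C * x] for the degree [x]. *)
Lemma degree_bound (F : seq E) w : uniq F -> (forall lam, lam \in F -> Lambda lam) ->
  \sum_(lam <- F) `|incidence lam w| <= C.
Proof.
move=> uF FL; have := upper (incidence^~ w) w uF FL.
have incE lam : incidence lam w ^+ 2 = `|incidence lam w|.
  by rewrite /incidence; case: eqP; case: eqP => _ _;
    rewrite /= ?subrr ?subr0 ?sub0r ?sqrrN ?normrN ?normr0 ?normr1 ?expr1n ?expr0n.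
rewrite /= (eq_bigr (fun lam => `|incidence lam w|)); last by move=> *; rewrite -expr2 incE.
set x := \sum_(_ <- _) _; have [->//|x0] := eqVneq x 0.
have x_gt0 : 0 < x by rewrite lt_def x0 sumr_ge0.
by rewrite expr2 ler_pM2r.
Qed.

(** The integer vector [edge_coord _ v] has finite support, contained in the edges
    of a first approximation [l].  If [W] contains [v] and all ends of these edges,
    the total over [W] of the boundary of a finer approximation [l'] only feels
    edges crossing out of [W].  Their number is bounded by the degrees in [W], and
    their coefficients are close to 0; so the total is close to 0, although it
    approximates the total mass 1 at [v]. *)
Lemma incidence_not_invertible v : vertex v -> False.
Proof.
move=> vv; have e0 : 0 < (4 * K)^-1 by rewrite invr_gt0 mulr_gt0.
have Ke : K * (4 * K)^-1 = 4^-1 by rewrite invfM mulrCA divff ?mulr1// gt_eqF.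
have close lam l r : supported Lambda l -> l2_le (fun w => vdelta v w - boundary l w) r ->
    `|edge_coord lam v - coef l lam| <= 2 * K * r.
  move=> ol lr; apply: (limit_coef_bound (lam := lam)) lr.
  have := limit_coefD (edge_coordP lam vv) (limit_coefZ (-1) (limit_coef_boundary lam ol)).
  by rewrite mulN1r; apply: limit_coef_ext => w; rewrite mulN1r.
have [l [ol lr]] := dense vv e0.
(* Outside [l] the integer [edge_coord lam v] is at most [1 / 2] in modulus, by the
   choice of the precision [1 / (4 * K)]. *)
have zero lam : Lambda lam -> lam \notin indices l -> edge_coord lam v = 0.
  move=> Ll lF; have := close lam _ _ ol lr; rewrite coef_out// subr0 -mulrA Ke.
  by case: (edge_coord_integral Ll vv) => // ->; lra.
pose W := undup (v :: [seq src lam | lam <- indices l] ++ [seq tgt lam | lam <- indices l]).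
have uW : uniq W by exact: undup_uniq.
have vW : v \in W by rewrite mem_undup mem_head.
pose n : R := (size W)%:R; have n0 : 0 <= n by rewrite ler0n.
have T0 : 0 < n * (1 + 2 * K * C) + 1.
  by rewrite ltr_wpDl// mulr_ge0// addr_ge0// !mulr_ge0// ltW.
(* At precision [d], the error of the total mass is at most [n * d] from the
   approximation and [2 * K * d * (n * C)] from the crossing edges. *)
have d0 : 0 < (n * (1 + 2 * K * C) + 1)^-1 by rewrite invr_gt0.
have [l' [ol' lr']] := dense vv d0.
set d := _^-1 in d0 lr'.
have dT : d * (n * (1 + 2 * K * C) + 1) = 1 by rewrite mulVf// gt_eqF.
have := l2_le_sum W lr'; rewrite sumrB sum_indicator// vW mulr1n -/n.
have : `|\sum_(w <- W) boundary l' w| <= 2 * K * d * (n * C).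
  have -> : \sum_(w <- W) boundary l' w =
      \sum_(lam <- indices l') coef l' lam * \sum_(w <- W) incidence lam w.
    under [RHS]eq_bigr do rewrite mulr_sumr.
    rewrite [RHS]exchange_big /=; apply: eq_bigr => w _.
    by apply: lincomb_coef => //; apply: undup_uniq.
  apply: (@le_trans _ _ (\sum_(lam <- indices l') 2 * K * d * \sum_(w <- W) `|incidence lam w|)).
    apply: le_trans (ler_norm_sum _ _ _) _.
    rewrite big_seq [leRHS]big_seq; apply: ler_sum => lam ll'.
    have dK : 0 <= 2 * K * d by rewrite !mulr_ge0// ltW.
    have sn : 0 <= \sum_(w <- W) `|incidence lam w| by rewrite sumr_ge0.
    have [ll|ll] := boolP (lam \in indices l).
      rewrite /incidence sumrB !sum_indicator//.
      have -> : src lam \in W.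
        by rewrite mem_undup inE mem_cat map_f ?orbT.
      have -> : tgt lam \in W.
        by rewrite mem_undup inE mem_cat [X in _ || X]orbC map_f ?orbT.
      by rewrite subrr mulr0 normr0 mulr_ge0.
    rewrite normrM; apply: ler_pM => //; last exact: ler_norm_sum.
    have := close lam _ _ ol' lr'; rewrite zero//; last exact: ol'.
    by rewrite sub0r normrN.
  rewrite -mulr_sumr ler_wpM2l//; first by rewrite !mulr_ge0// ltW.
  rewrite exchange_big /= mulrC /n mulr_natr -(count_predT W) -iter_addr_0 -big_const_seq.
  apply: ler_sum => w _; apply: degree_bound; last exact: ol'.
  exact: undup_uniq.
rewrite !ler_norml => /andP[? ?] /andP[? ?].
by lra.
Qed.

End Graph.

Lemma l2_le_sumtype (R : realType) (X Y : choiceType) (u : X + Y -> R) (r r' eps : R) :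
  (forall s : seq X, uniq s -> \sum_(a <- s) u (inl a) ^+ 2 <= r) ->
  (forall s : seq Y, uniq s -> \sum_(b <- s) u (inr b) ^+ 2 <= r') ->
  0 <= eps -> r + r' <= eps ^+ 2 -> l2_le u eps.
Proof.
move=> hx hy e0 re; split=> // s us.
pose ol (w : X + Y) := if w is inl a then Some a else None.
pose or (w : X + Y) := if w is inr b then Some b else None.
have -> : \sum_(w <- s) u w ^+ 2 = \sum_(a <- pmap ol s) u (inl a) ^+ 2
    + \sum_(b <- pmap or s) u (inr b) ^+ 2.
  elim: s {us} => [|[a|b] s IH] /=; rewrite ?big_nil ?addr0//.
    by rewrite !big_cons IH addrA.
  by rewrite !big_cons IH addrCA.
apply: le_trans re; apply: lerD; [apply: hx|apply: hy].
  by apply: (pmap_uniq (g := inl)) us; case.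
by apply: (pmap_uniq (g := inr)) us; case.
Qed.

(** * Bounded functions in a complex L2 space *)

Section ComplexFacts.
Context (R : rcfType).
Implicit Types z w : R[i].

Lemma normc_sqr z : normc z ^+ 2 = Re z ^+ 2 + Im z ^+ 2.
Proof. by case: z => a b /=; rewrite sqr_sqrtr// addr_ge0// sqr_ge0. Qed.

Lemma Re_mul z w : Re (z * w) = Re z * Re w - Im z * Im w.
Proof. by case: z w => [a b] [c d]. Qed.

Lemma Im_mul z w : Im (z * w) = Re z * Im w + Im z * Re w.
Proof. by case: z w => [a b] [c d]. Qed.

Lemma Re_conj z : Re (conjc z) = Re z. Proof. by case: z. Qed.
Lemma Im_conj z : Im (conjc z) = - Im z. Proof. by case: z. Qed.
Lemma Re_add z w : Re (z + w) = Re z + Re w. Proof. by case: z w => [? ?] []. Qed.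
Lemma Im_add z w : Im (z + w) = Im z + Im w. Proof. by case: z w => [? ?] []. Qed.
Lemma Re_opp z : Re (- z) = - Re z. Proof. by case: z. Qed.
Lemma Im_opp z : Im (- z) = - Im z. Proof. by case: z. Qed.

Definition ReImE := (Re_mul, Im_mul, Re_conj, Im_conj, Re_add, Im_add, Re_opp, Im_opp).

End ComplexFacts.

Section BoundedFunctions.
Context d (T : measurableType d) (R : realType).
Implicit Types (f g : T -> R[i]) (h : T -> R).

Definition bounded_real h := measurable_fun setT h /\ exists M, forall x, `|h x| <= M.

Definition bounded_cplx f := bounded_real (fun x => Re (f x)) /\ bounded_real (fun x => Im (f x)).

Lemma bounded_realD h h' : bounded_real h -> bounded_real h' ->
  bounded_real (fun x => h x + h' x).
Proof.
move=> [mh [M hM]] [mh' [M' hM']]; split; first exact: measurable_funD.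
by exists (M + M') => x; apply: le_trans (ler_normD _ _) _; exact: lerD.
Qed.

Lemma bounded_realM h h' : bounded_real h -> bounded_real h' ->
  bounded_real (fun x => h x * h' x).
Proof.
move=> [mh [M hM]] [mh' [M' hM']]; split; first exact: measurable_funM.
by exists (M * M') => x; rewrite normrM; exact: ler_pM.
Qed.

Lemma bounded_real_cst (k : R) : bounded_real (fun=> k).
Proof. by split; [exact: measurable_cst|exists `|k|]. Qed.

Lemma bounded_realN h : bounded_real h -> bounded_real (fun x => - h x).
Proof.
move=> bh; rewrite (_ : (fun _ => _) = (fun x => -1 * h x)).
  exact/bounded_realM/bh/bounded_real_cst.
by apply/funext => x; rewrite mulN1r.
Qed.

Lemma bounded_cplxD f g : bounded_cplx f -> bounded_cplx g ->
  bounded_cplx (fun x => f x + g x).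
Proof.
move=> [f1 f2] [g1 g2]; split.
  by have := bounded_realD f1 g1; congr bounded_real; apply/funext => x /=; rewrite ReImE.
by have := bounded_realD f2 g2; congr bounded_real; apply/funext => x /=; rewrite ReImE.
Qed.

Lemma bounded_cplxM f g : bounded_cplx f -> bounded_cplx g ->
  bounded_cplx (fun x => f x * g x).
Proof.
move=> [f1 f2] [g1 g2]; split.
  have := bounded_realD (bounded_realM f1 g1) (bounded_realN (bounded_realM f2 g2)).
  by congr bounded_real; apply/funext => x /=; rewrite ReImE.
have := bounded_realD (bounded_realM f1 g2) (bounded_realM f2 g1).
by congr bounded_real; apply/funext => x /=; rewrite ReImE.
Qed.

Lemma bounded_cplx_cst (z : R[i]) : bounded_cplx (fun=> z).
Proof. by split; exact: bounded_real_cst. Qed.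

Lemma bounded_cplx_lincomb (I : choiceType) (e : I -> T -> R[i]) (l : seq (R[i] * I)) :
  (forall i, i \in indices l -> bounded_cplx (e i)) ->
  bounded_cplx (fun x => lincomb l (e^~ x)).
Proof.
move=> h; have {h} : forall p, p \in l -> bounded_cplx (e p.2).
  by move=> p pl; apply: h; rewrite mem_undup map_f.
elim: l => [|p l IH] h.
  have := bounded_cplx_cst 0; congr bounded_cplx.
  by apply/funext => x; rewrite /lincomb big_nil.
have bp : bounded_cplx (fun x => p.1 * e p.2 x).
  by apply: bounded_cplxM; [exact: bounded_cplx_cst|apply: h; rewrite mem_head].
have bl : bounded_cplx (fun x => lincomb l (e^~ x)).
  by apply: IH => q ql; apply: h; rewrite in_cons ql orbT.
have := bounded_cplxD bp bl; congr bounded_cplx.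
by apply/funext => x; rewrite /lincomb big_cons.
Qed.

Context (sigma : {measure set T -> \bar R}).
Hypothesis sigma_fin : (sigma setT < +oo)%E.

Lemma bounded_integrable h : bounded_real h -> sigma.-integrable setT (EFin \o h).
Proof.
move=> [mh [M hM]]; apply: measurable_bounded_integrable => //.
exists M; split; first exact: num_real.
by move=> y My x _; apply: le_trans (hM x) (ltW My).
Qed.

(** The real part of [inner2 sigma f g], written as one real integral.  As a real
    inner product it determines the norm, and by [re_innerZr] also [inner2]. *)
Definition re_inner f g : R := \int[sigma]_x (Re (f x) * Re (g x) + Im (f x) * Im (g x)).

Lemma bounded_re_inner f g : bounded_cplx f -> bounded_cplx g ->
  bounded_real (fun x => Re (f x) * Re (g x) + Im (f x) * Im (g x)).
Proof.
by move=> [f1 f2] [g1 g2]; apply: bounded_realD; apply: bounded_realM.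
Qed.

Lemma sqnorm2E f : bounded_cplx f -> sqnorm2 sigma f = (re_inner f f)%:E.
Proof.
move=> bf; rewrite /sqnorm2 /re_inner /Rintegral fineK.
  by apply: eq_integral => x _; rewrite normc_sqr !expr2.
apply: integrable_fin_num => //; exact/bounded_integrable/bounded_re_inner.
Qed.

Lemma re_inner_ge0 f : 0 <= re_inner f f.
Proof. by apply: Rintegral_ge0 => x _; rewrite addr_ge0// -expr2 sqr_ge0. Qed.

Lemma inL2_bounded f : bounded_cplx f -> inL2 sigma f.
Proof. by move=> bf; case: (bf) => [[? _] [? _]]; split; rewrite ?sqnorm2E ?ltry. Qed.

Lemma re_innerDr f g g' : bounded_cplx f -> bounded_cplx g -> bounded_cplx g' ->
  re_inner f (fun x => g x + g' x) = re_inner f g + re_inner f g'.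
Proof.
move=> bf bg bg'; rewrite /re_inner -RintegralD//; try exact/bounded_integrable/bounded_re_inner.
by apply: eq_Rintegral => x _; rewrite !ReImE; ring.
Qed.

Lemma re_innerZr f (z : R[i]) g : bounded_cplx f -> bounded_cplx g ->
  re_inner f (fun x => z * g x) = Re (z * conjc (inner2 sigma f g)).
Proof.
move=> bf bg; have [f1 f2] := bf; have [g1 g2] := bg.
have b1 := bounded_re_inner bf bg.
have b2 : bounded_real (fun x => Im (f x) * Re (g x) - Re (f x) * Im (g x)).
  by apply: bounded_realD; [|apply: bounded_realN]; apply: bounded_realM.
transitivity (Re z * re_inner f g +
  Im z * \int[sigma]_x (Im (f x) * Re (g x) - Re (f x) * Im (g x))); last first.
  rewrite !ReImE mulrN opprK /inner2 /=; congr (_ * _ + _ * _).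
    by apply: eq_Rintegral => x _; rewrite !ReImE; ring.
  by apply: eq_Rintegral => x _; rewrite !ReImE; ring.
rewrite /re_inner -!RintegralZl//; try exact: bounded_integrable.
rewrite -RintegralD//; first last.
- exact/bounded_integrable/bounded_realM/b2/bounded_real_cst.
- exact/bounded_integrable/bounded_realM/b1/bounded_real_cst.
by apply: eq_Rintegral => x _; rewrite !ReImE; ring.
Qed.

Lemma re_inner_sub f g : bounded_cplx f -> bounded_cplx g ->
  re_inner (fun x => f x - g x) (fun x => f x - g x) =
  re_inner f f - 2 * re_inner f g + re_inner g g.
Proof.
move=> bf bg; have bff := bounded_re_inner bf bf; have bgg := bounded_re_inner bg bg.
have bfg := bounded_realM (bounded_real_cst (-2)) (bounded_re_inner bf bg).
rewrite -mulNr /re_inner -RintegralZl//; last exact/bounded_integrable/bounded_re_inner.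
rewrite -!RintegralD//; try by [exact: bounded_integrable|
  exact/bounded_integrable/bounded_realD].
by apply: eq_Rintegral => x _; rewrite !ReImE; ring.
Qed.

Context (I : choiceType) (e : I -> T -> R[i]) (Lambda : set I).
Hypothesis e_bounded : forall i, Lambda i -> bounded_cplx (e i).

Implicit Types l : seq (R[i] * I).

Lemma bounded_supported l : supported Lambda l ->
  bounded_cplx (fun x => lincomb l (e^~ x)).
Proof. by move=> ol; apply: bounded_cplx_lincomb => i /ol /e_bounded. Qed.

Lemma re_inner_lincomb f l : bounded_cplx f -> supported Lambda l ->
  re_inner f (fun x => lincomb l (e^~ x)) =
  \sum_(p <- l) Re (p.1 * conjc (inner2 sigma f (e p.2))).
Proof.
move=> bf; elim: l => [|p l IH] ol.
  rewrite big_nil /re_inner /Rintegral integral0_eq// => x _.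
  by rewrite /lincomb big_nil /= !mulr0 addr0.
have bp : bounded_cplx (e p.2).
  by apply/e_bounded/ol; rewrite mem_undup map_f ?mem_head.
have ol' : supported Lambda l.
  by move=> i; rewrite mem_undup => il; apply: ol; rewrite mem_undup in_cons il orbT.
rewrite big_cons -IH// -re_innerZr// -re_innerDr//; last 2 first.
- exact/bounded_cplxM/bp/bounded_cplx_cst.
- exact: bounded_supported.
by apply: eq_Rintegral => x _; rewrite /lincomb big_cons.
Qed.

(** Let [r] be the error of an approximation of [f] that is optimal up to [delta]
    in squared norm.  Replacing the approximation by its sum with [g], a finite
    combination of the [e i] with coefficients [t * <r, e i>], cannot gain more
    than [delta]; with [t = 1 / B] this bounds every finite sum of the
    [|<r, e i>|^2] by [delta * B].  The lower frame inequality turns this into a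
    bound for the norm of [r]. *)
Lemma frame_dense (B : R) : is_frame sigma e Lambda -> 0 < B ->
  (forall l, supported Lambda l ->
    re_inner (fun x => lincomb l (e^~ x)) (fun x => lincomb l (e^~ x)) <=
    B * \sum_(i <- indices l) normc (coef l i) ^+ 2) ->
  forall f (eps : R), bounded_cplx f -> 0 < eps -> exists l, supported Lambda l /\
    (sqnorm2 sigma (fun x => (f x - lincomb l (e^~ x))%R) <= eps%:E)%E.
Proof.
move=> [A [B' [A0 B'0 frame]]] B0 bessel f eps bf eps0.
pose res l := fun x => f x - lincomb l (e^~ x).
have bres l : supported Lambda l -> bounded_cplx (res l).
  move=> /bounded_supported bl; have := bounded_cplxD bf (bounded_cplxM (bounded_cplx_cst (-1)) bl).
  by congr bounded_cplx; apply/funext => x; rewrite mulN1r.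
pose D := [set y | exists2 l, supported Lambda l & y = re_inner (res l) (res l)].
have lbD : has_lbound D by exists 0 => _ [l _ ->]; exact: re_inner_ge0.
have infD : has_inf D.
  by split=> //; exists (re_inner (res [::]) (res [::])), [::].
have d0 : 0 < eps * A / B by rewrite divr_gt0// mulr_gt0.
(* The tolerance [delta = eps * A / B] makes [delta * B] equal to [eps * A]. *)
have [_ [l ol ->] near_inf] := inf_adherent d0 infD.
exists l; split=> //; rewrite -/(res l).
have brl := bres _ ol.
have [frl _] := andP (frame _ (inL2_bounded brl)).
rewrite sqnorm2E// lee_fin -(ler_pM2l A0) -lee_fin EFinM -sqnorm2E//.
apply: le_trans frl _; apply: ge_ereal_sup => _ [X [finX XL] <-].
pose a i := inner2 sigma (res l) (e i).
rewrite fsbig_finite// sumEFin lee_fin.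
set s : seq I := finmap.enum_fset (fset_set X).
have us : uniq s by exact: finmap.fset_uniq.
have sL i : i \in s -> Lambda i by rewrite [i \in s](in_fset_set finX) inE => /XL.
set Q := \sum_(i <- _) _.
pose t : R := B^-1.
pose l' := [seq (t%:C%C * a i, i) | i <- s].
have ol' : supported Lambda l' by move=> i; rewrite indices_fun// => /sL.
pose g x := lincomb l' (e^~ x).
have bg : bounded_cplx g by exact: bounded_supported.
have rg : re_inner (res l) g = t * Q.
  rewrite re_inner_lincomb// big_map mulr_sumr; apply: eq_bigr => i _.
  transitivity (Re ((t%:C%C * a i) * conjc (a i))) => //.
  rewrite -/(a i) normc_sqr.
  by case: (a i) => u v /=; ring.
have gg : re_inner g g <= t * Q.
  apply: le_trans (bessel _ ol') _; rewrite indices_fun//.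
  have -> : t * Q = B * \sum_(i <- s) t ^+ 2 * normc (a i) ^+ 2.
    by rewrite -mulr_sumr mulrA expr2 mulrA divff ?gt_eqF// mul1r.
  rewrite ler_pM2l// big_seq [leRHS]big_seq; apply: ler_sum => i si.
  by rewrite coef_fun// si !normc_sqr; case: (a i) => u v /=; nra.
have : inf D <= re_inner (res l) (res l) - 2 * (t * Q) + re_inner g g.
  rewrite -rg -re_inner_sub//; apply: ge_inf => //.
  exists (l ++ l'); first exact: supported_cat.
  by congr re_inner; apply/funext => x; rewrite /res lincomb_cat opprD addrA.
have tQ : B * (t * Q) = Q by rewrite mulrA divff ?mul1r// gt_eqF.
have : eps * A = B * (eps * A / B) by rewrite [RHS]mulrC divfK// gt_eqF.
move=> eA h; rewrite [leRHS]mulrC eA -tQ ler_pM2l//.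
by lra.
Qed.

End BoundedFunctions.

(** * Riesz sequences in terms of formal combinations *)

Section RealComplex.
Context (R : rcfType) (I : choiceType).

Definition complexify (l : seq (R * I)) : seq (R[i] * I) := [seq (p.1%:C%C, p.2) | p <- l].

Definition realpart (l : seq (R[i] * I)) : seq (R * I) := [seq (Re p.1, p.2) | p <- l].

Lemma indices_complexify l : indices (complexify l) = indices l.
Proof. by rewrite /indices -map_comp. Qed.

Lemma indices_realpart l : indices (realpart l) = indices l.
Proof. by rewrite /indices -map_comp. Qed.

Lemma lincomb_complexify l (f : I -> R) :
  lincomb (complexify l) (fun i => (f i)%:C%C) = (lincomb l f)%:C%C.
Proof.
rewrite /lincomb big_map rmorph_sum; apply: eq_bigr => p _.
by rewrite /= rmorphM.
Qed.

Lemma Re_lincomb l (f : I -> R) : Re (lincomb l (fun i => (f i)%:C%C)) = lincomb (realpart l) f.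
Proof.
rewrite /lincomb big_map; elim: l => [|p l IH]; first by rewrite !big_nil.
by rewrite !big_cons Re_add IH Re_mul /= mulr0 subr0.
Qed.

Lemma Re_coef l i : Re (coef l i) = coef (realpart l) i.
Proof.
rewrite /coef -Re_lincomb; congr (Re (lincomb _ _)); apply/funext => j.
by case: (_ == _).
Qed.

Lemma coef_complexify l i : coef (complexify l) i = (coef l i)%:C%C.
Proof.
rewrite /coef -lincomb_complexify; congr lincomb; apply/funext => j.
by case: (_ == _).
Qed.

Lemma normc_real (x : R) : normc x%:C%C ^+ 2 = x ^+ 2.
Proof. by rewrite normc_sqr /= [0 ^+ 2]expr0n addr0. Qed.

Lemma Re_le_normc (z : R[i]) : Re z ^+ 2 <= normc z ^+ 2.
Proof. by rewrite normc_sqr lerDl sqr_ge0. Qed.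

Lemma le_sum_mem (F : I -> R) (s : seq I) i :
  (forall j, 0 <= F j) -> (i \notin s -> F i = 0) -> uniq s -> F i <= \sum_(j <- s) F j.
Proof.
move=> F0 Fi us; have [si|/Fi ->] := boolP (i \in s); last exact: sumr_ge0.
by rewrite (bigD1_seq i) //= lerDl sumr_ge0.
Qed.

Lemma coef_le (l : seq (R * I)) i :
  coef l i ^+ 2 <= \sum_(j <- indices l) coef l j ^+ 2.
Proof.
apply: (@le_sum_mem (fun j => coef l j ^+ 2)) => [j|/coef_out ->|].
- exact: sqr_ge0.
- by rewrite expr0n.
- exact: undup_uniq.
Qed.

Lemma supported_complexify (D : set I) (l : seq (R * I)) :
  supported D l -> supported D (complexify l).
Proof. by move=> ol i; rewrite indices_complexify; apply: ol. Qed.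

Lemma sum_complexify (l : seq (R * I)) :
  \sum_(i <- indices (complexify l)) normc (coef (complexify l) i) ^+ 2 =
  \sum_(i <- indices l) coef l i ^+ 2.
Proof.
by rewrite indices_complexify; apply: eq_bigr => i _; rewrite coef_complexify normc_real.
Qed.

Lemma sum_Re_coef_le (L : seq (R[i] * I)) (u : I -> R) s :
  uniq s -> (forall i, u i ^+ 2 = Re (coef L i) ^+ 2) ->
  \sum_(i <- s) u i ^+ 2 <= \sum_(i <- indices L) normc (coef L i) ^+ 2.
Proof.
move=> us uL; apply: (@le_trans _ _ (\sum_(i <- s) normc (coef L i) ^+ 2)).
  by apply: ler_sum => i _; rewrite uL Re_le_normc.
apply: (@sum_le_on _ _ (fun i => normc (coef L i) ^+ 2)) => //.
- exact: undup_uniq.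
- by move=> i; exact: sqr_ge0.
- by move=> i /coef_out ->; rewrite ComplexField.Normc.normc0 expr0n.
Qed.

End RealComplex.

Section RieszComb.
Context d (T : measurableType d) (R : realType).
Context (sigma : {measure set T -> \bar R}) (I : choiceType).
Context (e : I -> T -> R[i]) (Lambda : set I).

Lemma fsum_indices (S : comPzRingType) (V : nmodType) (l : seq (S * I)) (F : I -> V) :
  supported Lambda l -> (forall i, i \notin indices l -> F i = 0) ->
  \sum_(i \in Lambda) F i = \sum_(i <- indices l) F i.
Proof.
move=> ol F0; rewrite [RHS]fsbig_seq ?undup_uniq//.
apply/esym; apply: (fsbig_widen [set` indices l] Lambda); first by move=> i /ol.
by move=> i /= [_ /negP/F0].
Qed.

Lemma riesz_lincomb : is_riesz_sequence sigma e Lambda ->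
  exists A B : R, [/\ 0 < A, 0 < B & forall l, supported Lambda l ->
    ((A * \sum_(i <- indices l) normc (coef l i) ^+ 2)%:E
      <= sqnorm2 sigma (fun x => lincomb l (e^~ x))
      <= (B * \sum_(i <- indices l) normc (coef l i) ^+ 2)%:E)%E].
Proof.
move=> [A [B [A0 B0 H]]]; exists A, B; split=> // l ol.
have := H (coef l); rewrite (@fsum_indices _ _ l)//; last first.
  by move=> i il; rewrite coef_out// ComplexField.Normc.normc0 expr0n.
rewrite (_ : (fun x => \sum_(i \in Lambda) coef l i * e i x) = (fun x => lincomb l (e^~ x))).
  apply; apply: (@sub_finite_set _ _ [set` indices l]); last exact: finite_seq.
  by move=> i [_] /=; apply: contraNT => /coef_out ->.
apply/funext => x; rewrite (@fsum_indices _ _ l)//.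
  by rewrite (@lincomb_coef _ _ l _ (indices l))// undup_uniq.
by move=> i il; rewrite coef_out// mul0r.
Qed.

End RieszComb.

(** * Exponentials and the additive measure *)

Section Exponentials.
Context (R : realType).
Local Notation line := (measurableTypeR R).

Lemma bounded_expi d (T : measurableType d) (h : T -> R) :
  measurable_fun setT h -> bounded_cplx (fun x => expi (h x)).
Proof.
move=> mh; split; split=> /=.
- exact: measurableT_comp (continuous_measurable_fun (@continuous_cos R)) mh.
- by exists 1 => x; rewrite ler_norml cos_geN1 cos_le1.
- exact: measurableT_comp (continuous_measurable_fun (@continuous_sin R)) mh.
- by exists 1 => x; rewrite ler_norml sin_geN1 sin_le1.
Qed.

Lemma bounded_e_line (a : R) : bounded_cplx (e_line a).
Proof.
apply: bounded_expi; apply: measurable_funM; first exact: measurable_cst.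
by apply: measurable_funM; [exact: measurable_cst|exact: measurable_id].
Qed.

Lemma bounded_e_plane (lam : R * R) : bounded_cplx (@e_plane R lam).
Proof.
apply: bounded_expi; apply: measurable_funM; first exact: measurable_cst.
apply: measurable_funD; apply: measurable_funM;
  by [exact: measurable_cst|exact: measurable_fst|exact: measurable_snd].
Qed.

(** The additive measure lives on the two axes, so that it splits squared norms. *)
Lemma sqnorm2_additive (mu nu : probability line R) (F : line * line -> R[i]) :
  bounded_cplx F ->
  sqnorm2 (additive_measure mu nu) F =
  ((2^-1)%:E * (sqnorm2 mu (fun x => F (x, 0%R)) + sqnorm2 nu (fun y => F (0%R, y))))%E.
Proof.
move=> [[mRe _] [mIm _]].
pose N z : \bar R := (normc (F z) ^+ 2)%:E.
have N0 z : (0 <= N z)%E by rewrite lee_fin sqr_ge0.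
have mN : measurable_fun setT N.
  apply/measurable_EFinP; rewrite (_ : (fun z => normc (F z) ^+ 2) =
    (fun z => Re (F z) ^+ 2 + Im (F z) ^+ 2)); last by apply/funext => z; exact: normc_sqr.
  by apply: measurable_funD; apply: measurable_funX.
have dirac0 (h : line -> \bar R) : measurable_fun setT h ->
    (\int[\d_(0%R : line)]_y h y = h 0%R)%E.
  by move=> mh; rewrite integral_dirac// diracT mul1e.
rewrite /sqnorm2 /additive_measure (@ge0_integral_mscale _ _ _ _ _ _ _ N)//.
rewrite (@ge0_integral_measure_add _ _ _ _ _ _ _ N)//.
rewrite fubini_tonelli1// fubini_tonelli2//.
congr (_ * (_ + _))%E; apply: eq_integral => x _; apply: dirac0.
  exact: measurableT_comp mN (pair1_measurable x).
exact: measurableT_comp mN (pair2_measurable x).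
Qed.

End Exponentials.

Section NormFacts.
Context d (T : measurableType d) (R : realType) (sigma : {measure set T -> \bar R}).

Lemma sqnorm2_negligible (N : set T) (f g : T -> R[i]) :
  measurable N -> sigma N = 0%E -> bounded_cplx f -> bounded_cplx g ->
  (forall x, ~ N x -> f x = g x) -> sqnorm2 sigma f = sqnorm2 sigma g.
Proof.
move=> mN N0 bf bg fg.
have msq (h : T -> R[i]) : bounded_cplx h -> measurable_fun setT (fun x => (normc (h x) ^+ 2)%:E).
  move=> [[mRe _] [mIm _]]; apply/measurable_EFinP.
  rewrite (_ : (fun x => normc (h x) ^+ 2) = (fun x => Re (h x) ^+ 2 + Im (h x) ^+ 2)).
    by apply: measurable_funD; apply: measurable_funX.
  by apply/funext => x; exact: normc_sqr.
have sq_ge0 h x : (0 <= (normc (h x) ^+ 2)%:E :> \bar R)%E by rewrite lee_fin sqr_ge0.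
rewrite /sqnorm2 (ge0_negligible_integral mN measurableT (msq _ bf))//.
rewrite [RHS](ge0_negligible_integral mN measurableT (msq _ bg))//.
by apply: eq_integral => x; rewrite inE => -[_ /fg ->].
Qed.

Lemma sqnorm2_one : sqnorm2 sigma (fun=> 1) = sigma setT.
Proof.
rewrite /sqnorm2; under eq_integral do rewrite ComplexField.Normc.normc1 expr1n.
by rewrite integral_cst// mul1e.
Qed.

Lemma riesz_lincomb_re_inner (I : choiceType) (e : I -> T -> R[i]) (Lambda : set I) :
  (sigma setT < +oo)%E -> (forall i, Lambda i -> bounded_cplx (e i)) ->
  is_riesz_sequence sigma e Lambda ->
  exists A B : R, [/\ 0 < A, 0 < B & forall l, supported Lambda l ->
    A * \sum_(i <- indices l) normc (coef l i) ^+ 2 <=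
    re_inner sigma (fun x => lincomb l (e^~ x)) (fun x => lincomb l (e^~ x)) <=
    B * \sum_(i <- indices l) normc (coef l i) ^+ 2].
Proof.
move=> fin be /riesz_lincomb [A [B [A0 B0 H]]]; exists A, B; split=> // l ol.
by have := H _ ol; rewrite sqnorm2E ?lee_fin//; exact: bounded_supported ol.
Qed.

End NormFacts.

(** * The graph of a planar spectrum *)

Section Additive.
Context (R : realType) (mu nu : probability (measurableTypeR R) R).
Context (Lambda : set (R * R)).
Local Notation line := (measurableTypeR R).
Local Notation rho := (additive_measure mu nu).
Implicit Types (l : seq (R * (R * R))).

(** The two projections are kept apart as the two summands of [R + R], since a
    number may be the abscissa of one point and the ordinate of another. *)
Definition xvertex (lam : R * R) : R + R := inl lam.1.
Definition yvertex (lam : R * R) : R + R := inr lam.2.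

Local Notation bdry := (@boundary R (R + R)%type (R * R)%type xvertex yvertex).

Lemma boundary_inl l a : bdry l (inl a) = coef (relabel fst l) a.
Proof.
rewrite /coef lincomb_relabel; congr lincomb; apply/funext => lam.
by rewrite /incidence /xvertex /yvertex /= subr0.
Qed.

(** The sign of the incidence matrix on the second side is harmless for norms; it is
    what makes every column sum to 0. *)
Lemma boundary_inr l b : bdry l (inr b) = - coef (relabel snd l) b.
Proof.
rewrite /coef lincomb_relabel -mulN1r -lincomb_scale /lincomb big_map.
apply: eq_bigr => p _.
by rewrite /incidence /xvertex /yvertex /= sub0r mulrN mulN1r mulNr.
Qed.

Lemma supported_fst (S : comPzRingType) (l : seq (S * (R * R))) :
  supported Lambda l -> supported (proj_x Lambda) (relabel fst l).
Proof.
move=> ol a; rewrite mem_undup -map_comp => /mapP [[s [a' b]] pl /= ->].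
by exists b; apply: ol; rewrite mem_undup; apply/mapP; exists (s, (a', b)).
Qed.

Lemma supported_snd (S : comPzRingType) (l : seq (S * (R * R))) :
  supported Lambda l -> supported (proj_y Lambda) (relabel snd l).
Proof.
move=> ol b; rewrite mem_undup -map_comp => /mapP [[s [a b']] pl /= ->].
by exists a; apply: ol; rewrite mem_undup; apply/mapP; exists (s, (a, b')).
Qed.

Lemma probability_fin (P : probability line R) : (P setT < +oo)%E.
Proof. by rewrite probability_setT ltry. Qed.

Lemma rho_fin : (rho setT < +oo)%E.
Proof.
have E := sqnorm2_additive mu nu (bounded_cplx_cst (line * line)%type 1).
rewrite !sqnorm2_one in E; apply: (@le_lt_trans _ _ ((2^-1)%:E * (mu setT + nu setT))%E).
  by rewrite -E.
by rewrite (probability_setT mu) (probability_setT nu) ltry.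
Qed.

Lemma re_inner_plane (F : line * line -> R[i]) : bounded_cplx F ->
  bounded_cplx (fun x : line => F (x, 0)) -> bounded_cplx (fun y : line => F (0, y)) ->
  re_inner rho F F = 2^-1 * (re_inner mu (fun x => F (x, 0)) (fun x => F (x, 0)) +
                       re_inner nu (fun y => F (0, y)) (fun y => F (0, y))).
Proof.
move=> bF b1 b2; have := sqnorm2_additive mu nu bF.
by rewrite !sqnorm2E//; [move=> [] | exact: probability_fin|exact: probability_fin|exact: rho_fin].
Qed.

Lemma lincomb_plane_x (l : seq (R[i] * (R * R))) (x : line) :
  lincomb l (@e_plane R ^~ (x, 0)) = lincomb (relabel fst l) (@e_line R ^~ x).
Proof.
rewrite lincomb_relabel; congr lincomb; apply/funext => lam.
by rewrite /e_plane /e_line /= mulr0 addr0.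
Qed.

Lemma lincomb_plane_y (l : seq (R[i] * (R * R))) (y : line) :
  lincomb l (@e_plane R ^~ (0, y)) = lincomb (relabel snd l) (@e_line R ^~ y).
Proof.
rewrite lincomb_relabel; congr lincomb; apply/funext => lam.
by rewrite /e_plane /e_line /= mulr0 add0r.
Qed.

Lemma bounded_lincomb_line (l : seq (R[i] * R)) :
  bounded_cplx (fun x : line => lincomb l (@e_line R ^~ x)).
Proof. by apply: bounded_cplx_lincomb => i _; exact: bounded_e_line. Qed.

Lemma bounded_lincomb_plane (l : seq (R[i] * (R * R))) :
  bounded_cplx (fun z : line * line => lincomb l (@e_plane R ^~ z)).
Proof. by apply: bounded_cplx_lincomb => i _; exact: bounded_e_plane. Qed.

Definition sqn_line (P : probability line R) (l : seq (R[i] * R)) : R :=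
  re_inner P (fun x => lincomb l (@e_line R ^~ x)) (fun x => lincomb l (@e_line R ^~ x)).

Definition sqn_plane (l : seq (R[i] * (R * R))) : R :=
  re_inner rho (fun x => lincomb l (@e_plane R ^~ x)) (fun x => lincomb l (@e_plane R ^~ x)).

(** An exponential polynomial on the plane restricts on each axis to the exponential
    polynomial whose coefficients are collected along the projection.  Up to
    the sign on the second side, these coefficients are the boundary values. *)
Lemma sqn_planeE (l : seq (R[i] * (R * R))) :
  sqn_plane l = 2^-1 * (sqn_line mu (relabel fst l) + sqn_line nu (relabel snd l)).
Proof.
have ex : (fun x : line => lincomb l (@e_plane R ^~ (x, 0))) =
    (fun x => lincomb (relabel fst l) (@e_line R ^~ x)) by apply/funext/lincomb_plane_x.
have ey : (fun y : line => lincomb l (@e_plane R ^~ (0, y))) =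
    (fun y => lincomb (relabel snd l) (@e_line R ^~ y)) by apply/funext/lincomb_plane_y.
rewrite /sqn_plane re_inner_plane ?ex ?ey//;
  [exact: bounded_lincomb_plane|exact: bounded_lincomb_line..].
Qed.

Context (A1 B1 A2 B2 A B : R).
Hypotheses (A1_gt0 : 0 < A1) (B1_gt0 : 0 < B1) (A2_gt0 : 0 < A2) (B2_gt0 : 0 < B2)
  (A_gt0 : 0 < A) (B_gt0 : 0 < B).
Hypothesis riesz_x : forall l : seq (R[i] * R), supported (proj_x Lambda) l ->
  A1 * \sum_(i <- indices l) normc (coef l i) ^+ 2 <= sqn_line mu l <=
  B1 * \sum_(i <- indices l) normc (coef l i) ^+ 2.
Hypothesis riesz_y : forall l : seq (R[i] * R), supported (proj_y Lambda) l ->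
  A2 * \sum_(i <- indices l) normc (coef l i) ^+ 2 <= sqn_line nu l <=
  B2 * \sum_(i <- indices l) normc (coef l i) ^+ 2.
Hypothesis riesz_rho : forall l : seq (R[i] * (R * R)), supported Lambda l ->
  A * \sum_(i <- indices l) normc (coef l i) ^+ 2 <= sqn_plane l <=
  B * \sum_(i <- indices l) normc (coef l i) ^+ 2.

Lemma relabel_complexify (h : R * R -> R) l :
  relabel h (complexify l) = complexify (relabel h l).
Proof. by rewrite /relabel /complexify -!map_comp. Qed.

Lemma incidence_lower l lam r : supported Lambda l -> l2_le (bdry l) r ->
  `|coef l lam| <= Num.sqrt ((B1 + B2) / A) * r.
Proof.
move=> ol [r0 lr].
have olc := supported_complexify ol.
have := riesz_rho olc; rewrite sqn_planeE !relabel_complexify sum_complexify => /andP[h _].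
have := riesz_x (supported_complexify (supported_fst ol)); rewrite sum_complexify => /andP[_ h1].
have := riesz_y (supported_complexify (supported_snd ol)); rewrite sum_complexify => /andP[_ h2].
have s1 : \sum_(i <- indices (relabel fst l)) coef (relabel fst l) i ^+ 2 <= r ^+ 2.
  have := lr [seq inl i | i <- indices (relabel fst l)]; rewrite big_map.
  under eq_bigr do rewrite boundary_inl; apply.
  by rewrite map_inj_uniq ?undup_uniq// => ? ? [].
have s2 : \sum_(i <- indices (relabel snd l)) coef (relabel snd l) i ^+ 2 <= r ^+ 2.
  have := lr [seq inr i | i <- indices (relabel snd l)]; rewrite big_map.
  under eq_bigr do rewrite boundary_inr sqrrN; apply.
  by rewrite map_inj_uniq ?undup_uniq// => ? ? [].
have h3 := ler_wpM2l (ltW B1_gt0) s1; have h4 := ler_wpM2l (ltW B2_gt0) s2.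
have h5 := ler_wpM2l (ltW A_gt0) (coef_le l lam).
have BA : 0 <= (B1 + B2) / A by rewrite divr_ge0 ?addr_ge0// ltW.
rewrite -(@ler_pXn2r _ 2) ?nnegrE ?mulr_ge0 ?sqrtr_ge0// exprMn sqr_sqrtr//.
rewrite real_normK ?num_real// mulrAC ler_pdivlMr// mulrC.
have r2 := sqr_ge0 r; have := mulr_ge0 (ltW B1_gt0) r2; have := mulr_ge0 (ltW B2_gt0) r2.
lra.
Qed.

Lemma incidence_upper (F : seq (R * R)) (c : R * R -> R) w : uniq F ->
  (forall lam, lam \in F -> Lambda lam) ->
  (\sum_(lam <- F) c lam * incidence R xvertex yvertex lam w) ^+ 2 <=
  (2 * B * (A1^-1 + A2^-1)) * \sum_(lam <- F) c lam ^+ 2.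
Proof.
move=> uF FL; pose l := [seq (c lam, lam) | lam <- F].
have -> : \sum_(lam <- F) c lam * incidence R xvertex yvertex lam w = bdry l w.
  by rewrite /bdry lincomb_fun.
have ol : supported Lambda l by move=> lam; rewrite indices_fun//; exact: FL.
have -> : \sum_(lam <- F) c lam ^+ 2 = \sum_(lam <- indices l) coef l lam ^+ 2.
  rewrite indices_fun// big_seq [RHS]big_seq; apply: eq_bigr => lam lF.
  by rewrite coef_fun// lF.
have := riesz_rho (supported_complexify ol).
rewrite sqn_planeE !relabel_complexify sum_complexify => /andP[_ h].
have := riesz_x (supported_complexify (supported_fst ol)); rewrite sum_complexify => /andP[h1 _].
have := riesz_y (supported_complexify (supported_snd ol)); rewrite sum_complexify => /andP[h2 _].
set S := \sum_(_ <- indices l) _ in h *.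
set Sx := \sum_(_ <- _) _ in h1; set Sy := \sum_(_ <- _) _ in h2.
have Sx0 : 0 <= Sx by apply: sumr_ge0 => *; exact: sqr_ge0.
have Sy0 : 0 <= Sy by apply: sumr_ge0 => *; exact: sqr_ge0.
have S0 : 0 <= S by apply: sumr_ge0 => *; exact: sqr_ge0.
have h1' : Sx <= 2 * B * A1^-1 * S.
  rewrite [leRHS]mulrAC ler_pdivlMr// mulrC.
  by have := mulr_ge0 (ltW A2_gt0) Sy0; lra.
have h2' : Sy <= 2 * B * A2^-1 * S.
  rewrite [leRHS]mulrAC ler_pdivlMr// mulrC.
  by have := mulr_ge0 (ltW A1_gt0) Sx0; lra.
rewrite mulrDr mulrDl.
case: w => [a|b].
  by rewrite boundary_inl; apply: (le_trans (coef_le _ _)); rewrite -/Sx; lra.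
by rewrite boundary_inr sqrrN; apply: (le_trans (coef_le _ _)); rewrite -/Sy; lra.
Qed.

Hypothesis frame_rho : is_frame rho (@e_plane R) Lambda.
Hypothesis nu0 : nu [set (0 : R)] = 0%E.

Lemma bounded_slice (F : line * line -> R[i]) : bounded_cplx F ->
  bounded_cplx (fun y : line => F (0, y)).
Proof.
move=> [[m1 [M1 h1]] [m2 [M2 h2]]]; split; split.
- exact: measurable_fun_pair2 m1.
- by exists M1 => y; apply: h1.
- exact: measurable_fun_pair2 m2.
- by exists M2 => y; apply: h2.
Qed.

(** A function in L2 of the additive measure whose restrictions to the two axes are
    prescribed multiples of exponentials; the origin, where the axes meet, has
    measure 0 on the second axis. *)
Definition axis (al be : R) (lam : R * R) (z : line * line) : R[i] :=
  if z.2 == 0 then al%:C%C * e_line lam.1 z.1 else be%:C%C * e_line lam.2 z.2.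

Lemma bounded_axis al be lam : bounded_cplx (axis al be lam).
Proof.
pose chi (z : line * line) : R[i] := (\1_[set (0 : R)] z.2)%:C%C.
have bchi : bounded_cplx chi.
  split; last exact: bounded_real_cst.
  have mchi : measurable_fun setT (fun z : line * line => \1_[set (0 : R)] z.2 : R).
    apply: (@measurableT_comp _ _ _ _ _ _ (\1_[set (0 : R)] : line -> R)).
      by apply: measurable_indic; exact: measurable_set1.
    exact: measurable_snd.
  split; first exact: mchi.
  by exists 1 => z; rewrite /chi /= indicE; case: (_ \in _); rewrite ?normr1 ?normr0.
have bx : bounded_cplx (fun z : line * line => al%:C%C * e_line lam.1 z.1).
  apply: bounded_cplxM; first exact: bounded_cplx_cst.
  apply: bounded_expi; apply: measurable_funM; first exact: measurable_cst.
  by apply: measurable_funM; [exact: measurable_cst|exact: measurable_fst].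
have by_ : bounded_cplx (fun z : line * line => be%:C%C * e_line lam.2 z.2).
  apply: bounded_cplxM; first exact: bounded_cplx_cst.
  apply: bounded_expi; apply: measurable_funM; first exact: measurable_cst.
  by apply: measurable_funM; [exact: measurable_cst|exact: measurable_snd].
have bN : bounded_cplx (fun z => 1 + (-1) * chi z).
  by do 2?[apply: bounded_cplxD || apply: bounded_cplxM] => //; exact: bounded_cplx_cst.
have := bounded_cplxD (bounded_cplxM bchi bx) (bounded_cplxM bN by_).
congr bounded_cplx; apply/funext => z; rewrite /axis /chi indicE.
case: eqVneq => [z0|z0].
  by rewrite mem_set// mul1r mulN1r subrr mul0r addr0.
by rewrite memNset ?mul0r ?mulr0 ?addr0 ?mul1r ?add0r//; exact/eqP.
Qed.

Lemma axis_approx al be lam eps : Lambda lam -> 0 < eps ->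
  exists l : seq (R[i] * (R * R)), supported Lambda l /\
  sqn_line mu ((al%:C%C, lam.1) :: scalel (-1) (relabel fst l)) +
  sqn_line nu ((be%:C%C, lam.2) :: scalel (-1) (relabel snd l)) <= eps.
Proof.
move=> Llam eps0; have e2 : 0 < 2^-1 * eps by rewrite mulr_gt0.
have [l [ol near]] := frame_dense rho_fin (fun lam _ => bounded_e_plane lam) frame_rho B_gt0
  (fun _ ol => proj2 (andP (riesz_rho ol))) (bounded_axis al be lam) e2.
exists l; split=> //.
set Lx := _ :: _; set Ly := _ :: _.
have bcl L := bounded_lincomb_line L.
have bres : bounded_cplx (fun z => axis al be lam z - lincomb l (@e_plane R ^~ z)).
  have := bounded_cplxD (bounded_axis al be lam)
    (bounded_cplxM (bounded_cplx_cst _ (-1)) (bounded_lincomb_plane l)).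
  by congr bounded_cplx; apply/funext => z; rewrite mulN1r.
move: near; rewrite sqnorm2_additive//.
have -> : (fun x : line => axis al be lam (x, 0) - lincomb l (@e_plane R ^~ (x, 0))) =
    (fun x => lincomb Lx (@e_line R ^~ x)).
  apply/funext => x; rewrite lincomb_plane_x /axis /= eqxx.
  by rewrite lincomb_cons lincomb_scale mulN1r.
(* On the second axis the restriction of [axis] differs from the exponential at 0. *)
rewrite (@sqnorm2_negligible _ _ _ nu [set (0 : R)] _ (fun y => lincomb Ly (@e_line R ^~ y)))//;
  last 2 first.
- exact: bounded_slice bres.
- move=> y /= /eqP y0; rewrite lincomb_plane_y /axis /= (negbTE y0).
  by rewrite lincomb_cons lincomb_scale mulN1r.
rewrite (sqnorm2E (probability_fin mu))// (sqnorm2E (probability_fin nu))// lee_fin.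
by rewrite ler_pM2l// invr_gt0.
Qed.

(** Approximating [axis] in the plane approximates a unit mass at one end of [lam]:
    on each axis the error is an exponential polynomial, and the lower Riesz
    inequality there controls its coefficients. *)
Lemma incidence_dense v eps : vertex xvertex yvertex Lambda v -> 0 < eps ->
  exists l, supported Lambda l /\ l2_le (fun w => vdelta R v w - bdry l w) eps.
Proof.
move=> [lam Llam vlam] eps0.
have [al [be targetE]] : exists al be : R, forall w, vdelta R v w =
    match w with inl a => al * (lam.1 == a)%:R | inr b => - be * (lam.2 == b)%:R end.
  (* The sign accounts for the entry -1 of the incidence matrix at the second end. *)
  case: vlam => <-; [exists 1, 0|exists 0, (-1)] => -[a|b];
    by rewrite /vdelta /xvertex /yvertex /= ?oppr0 ?opprK ?mul0r ?mul1r.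
have d0 : 0 < eps ^+ 2 / (A1^-1 + A2^-1).
  by rewrite divr_gt0 ?exprn_gt0// addr_gt0// invr_gt0.
have [l [ol le]] := axis_approx al be Llam d0.
set d := _ / _ in d0 le.
have dE : d * A1^-1 + d * A2^-1 = eps ^+ 2.
  by rewrite -mulrDr divfK// gt_eqF// addr_gt0// invr_gt0.
(* The targets are real, so that taking real parts of the coefficients can only
   improve the approximation. *)
exists (realpart l); split; first by move=> i; rewrite indices_realpart; apply: ol.
set Lx := _ :: scalel _ (relabel fst l) in le; set Ly := _ :: scalel _ (relabel snd l) in le.
have oLx : supported (proj_x Lambda) Lx.
  apply: (@supported_cat _ _ _ [:: _]); last exact: supported_scale (supported_fst ol).
  by move=> i; rewrite /indices /= inE => /eqP ->; exists lam.2; rewrite /= -surjective_pairing.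
have oLy : supported (proj_y Lambda) Ly.
  apply: (@supported_cat _ _ _ [:: _]); last exact: supported_scale (supported_snd ol).
  by move=> i; rewrite /indices /= inE => /eqP ->; exists lam.1; rewrite /= -surjective_pairing.
have /andP[hx _] := riesz_x oLx; have /andP[hy _] := riesz_y oLy.
have qx : 0 <= sqn_line mu Lx by exact: re_inner_ge0.
have qy : 0 <= sqn_line nu Ly by exact: re_inner_ge0.
have realpart_relabel h : realpart (relabel h l) = relabel h (realpart l).
  by rewrite /realpart /relabel -!map_comp.
have Recoef (x : R) i h j : Re (coef ((x%:C%C, i) :: scalel (-1) (relabel h l)) j) =
    x * (i == j)%:R - coef (relabel h (realpart l)) j.
  rewrite /coef lincomb_cons lincomb_scale -/(coef _ _).
  rewrite mulN1r Re_add Re_opp Re_coef realpart_relabel Re_mul /= mul0r subr0.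
  by case: (i == j).
apply: (@l2_le_sumtype _ _ _ _ (d * A1^-1) (d * A2^-1)); rewrite ?dE ?(ltW eps0)//.
  move=> s us; apply: (@le_trans _ _ (\sum_(i <- indices Lx) normc (coef Lx i) ^+ 2)).
    apply: sum_Re_coef_le => // a.
    by rewrite Recoef targetE boundary_inl.
  by rewrite ler_pdivlMr// mulrC; apply: (le_trans hx); lra.
move=> s us; apply: (@le_trans _ _ (\sum_(i <- indices Ly) normc (coef Ly i) ^+ 2)).
  apply: sum_Re_coef_le => // b.
  by rewrite Recoef targetE boundary_inr; ring.
by rewrite ler_pdivlMr// mulrC; apply: (le_trans hy); lra.
Qed.

Lemma no_simultaneous_riesz lam : Lambda lam -> False.
Proof.
move=> Llam; apply: (@incidence_not_invertible R (R + R)%type (R * R)%type xvertex yvertex Lambda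
  (Num.sqrt ((B1 + B2) / A)) (2 * B * (A1^-1 + A2^-1)) _ _ _ _ _ (xvertex lam)).
- by rewrite sqrtr_gt0 divr_gt0// addr_gt0.
- exact: incidence_lower.
- exact: incidence_upper.
- exact: incidence_dense.
- by rewrite !mulr_ge0 ?addr_ge0 ?invr_ge0// ltW.
- by exists lam => //; left.
Qed.

End Additive.

Theorem theorem1p2 (R : realType) (mu nu : probability (measurableTypeR R) R)
    (Lambda : set (R * R)) :
  continuous_measure mu -> continuous_measure nu ->
  countable Lambda ->
  is_riesz_basis (additive_measure mu nu) (@e_plane R) Lambda ->
  ~ is_riesz_basis mu (@e_line R) (proj_x Lambda) \/
  ~ is_riesz_basis nu (@e_line R) (proj_y Lambda).
Proof.
move=> _ nu0 _ [frame_rho riesz_rho]; apply: contrapT.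
move=> /not_orP [/contrapT [frame_x riesz_x] /contrapT [_ riesz_y]].
(* An empty set of frequencies is not a frame: the constant function 1 is not 0. *)
have [lam Llam] : exists lam, Lambda lam.
  apply: contrapT => empty.
  have x0 : proj_x Lambda = set0 by rewrite -subset0 => a [b ab]; case: empty; exists (a, b).
  have [A [B [A0 _ /(_ _ (inL2_bounded (probability_fin mu) (bounded_cplx_cst _ 1)))]]] := frame_x.
  have mu1 : sqnorm2 mu (fun=> 1) = 1%E.
    by rewrite sqnorm2_one; exact: probability_setT.
  rewrite x0 esum_set0 mu1 mule1 => /andP[].
  by rewrite lee_fin leNgt A0.
have be1 a (_ : proj_x Lambda a) := bounded_e_line a.
have be2 b (_ : proj_y Lambda b) := bounded_e_line b.
have be lam' (_ : Lambda lam') := bounded_e_plane lam'.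
have [A1 [B1 [A1_gt0 B1_gt0 h1]]] := riesz_lincomb_re_inner (probability_fin mu) be1 riesz_x.
have [A2 [B2 [A2_gt0 B2_gt0 h2]]] := riesz_lincomb_re_inner (probability_fin nu) be2 riesz_y.
have [A [B [A_gt0 B_gt0 h]]] := riesz_lincomb_re_inner (rho_fin mu nu) be riesz_rho.
exact: (no_simultaneous_riesz A1_gt0 B1_gt0 A2_gt0 B2_gt0 A_gt0 B_gt0
  h1 h2 h frame_rho (nu0 0) Llam).
Qed.
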